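(* Let $n\ge 2$ be an integer. Then every $\mathbb{Z}/n$-equivariant simplicial map $f\colon\Delta_{n,2n-1}\to\Delta_{n-1}$ is surjective (as a map of geometric realizations).
   Context: The chessboard complex $\Delta_{m,n}$ is the simplicial complex on vertex set $[m]\times[n]$ whose faces are the sets in which any two distinct elements differ in both coordinates. For $\Delta_{n,2n-1}$ the row set is identified with $\mathbb{Z}/n$ and $\mathbb{Z}/n$ acts by $j\cdot(i,\ell)=(i+j,\ell)$. $\Delta_{n-1}$ is the simplex with vertex set $\mathbb{Z}/n$, with $\mathbb{Z}/n$ acting by $k\mapsto k+j$ on vertices. A simplicial map sends vertices to vertices and faces into faces, and is extended to geometric realizations by linear interpolation. *)

(* Defs.v *)
From HB Require Import structures.
From mathcomp Require Import all_boot all_order all_algebra.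
From mathcomp Require Import reals.

Set Implicit Arguments.
Unset Strict Implicit.
Unset Printing Implicit Defensive.

Import Order.TTheory GRing.Theory Num.Theory.
Local Open Scope ring_scope.

(* The empty face is allowed; it carries no point of the realization. *)
Record simplicial_complex (V : finType) := SimplicialComplex {
  faces : {set {set V}};
  vertex_face : forall v, [set v] \in faces;
  face_sub : forall s t : {set V}, s \in faces -> t \subset s -> t \in faces
}.

Record simplicial_map (V W : finType)
    (K : simplicial_complex V) (L : simplicial_complex W) := SimplicialMap {
  vertex_map :> V -> W;
  map_face : forall s : {set V}, s \in faces K -> vertex_map @: s \in faces L
}.

Section Realization.
Variables (R : realFieldType) (V : finType) (K : simplicial_complex V).

(* Barycentric coordinates. *)
Definition in_realization (x : {ffun V -> R}) : bool :=
  [&& [forall v, 0 <= x v], \sum_v x v == 1 & [set v | x v != 0] \in faces K].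

Record realization := RealizationPoint {
  coords :> {ffun V -> R};
  coordsP : in_realization coords
}.

HB.instance Definition _ := [isSub for coords].

End Realization.

Section RealizationMap.
Variables (R : realFieldType) (V W : finType).
Variables (K : simplicial_complex V) (L : simplicial_complex W).
Variable f : simplicial_map K L.

(* Linear extension: \sum_v x_v v is sent to \sum_v x_v f(v). *)
Definition push_coords (x : {ffun V -> R}) : {ffun W -> R} :=
  [ffun w => \sum_(v | f v == w) x v].

Lemma push_coordsP (x : realization R K) : in_realization L (push_coords x).
Proof.
have /and3P[/forallP x_ge0 /eqP sum_x supp_x] := coordsP x.
apply/and3P; split.
- by apply/forallP => w; rewrite ffunE sumr_ge0.
- rewrite -sum_x (partition_big f xpredT) //=.
  by apply/eqP/eq_bigr => w _; rewrite ffunE.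
- apply: face_sub (map_face f supp_x) _; apply/subsetP => w.
  rewrite inE ffunE => sum_neq0; apply/negPn/negP => w_notin.
  case/negP: sum_neq0; apply/eqP/big1 => v /eqP fv.
  by apply/eqP; apply: contraR w_notin => xv; rewrite -fv imset_f ?inE.
Qed.

Definition realization_map (x : realization R K) : realization R L :=
  RealizationPoint (push_coordsP x).

End RealizationMap.

Section Chessboard.
Variables I J : finType.

Definition chessboard_faces : {set {set I * J}} :=
  [set s : {set I * J} | [forall a in s, forall b in s,
     (a != b) ==> ((a.1 != b.1) && (a.2 != b.2))]].

Lemma chessboard_vertex v : [set v] \in chessboard_faces.
Proof.
rewrite inE; apply/forall_inP => a /set1P ->.
by apply/forall_inP => b /set1P ->; rewrite eqxx.
Qed.

Lemma chessboard_sub (s t : {set I * J}) :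
  s \in chessboard_faces -> t \subset s -> t \in chessboard_faces.
Proof.
rewrite !inE => /forall_inP s_face /subsetP ts.
apply/forall_inP => a /ts/s_face/forall_inP a_face.
by apply/forall_inP => b /ts/a_face.
Qed.

Definition chessboard : simplicial_complex (I * J)%type :=
  SimplicialComplex chessboard_vertex chessboard_sub.

End Chessboard.

Section Simplex.
Variable V : finType.

Lemma simplex_vertex (v : V) : [set v] \in [set: {set V}].
Proof. by rewrite inE. Qed.

Lemma simplex_sub (s t : {set V}) :
  s \in [set: {set V}] -> t \subset s -> t \in [set: {set V}].
Proof. by rewrite !inE. Qed.

Definition simplex : simplicial_complex V :=
  SimplicialComplex simplex_vertex simplex_sub.

End Simplex.

Definition equivariant (G V W : Type) (actV : G -> V -> V) (actW : G -> W -> W)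
    (f : V -> W) : Prop :=
  forall g v, f (actV g v) = actW g (f v).

(* 'Z_n has n elements only when 1 < n. *)
Definition row_shift (n : nat) (J : Type) (j : 'Z_n) (v : 'Z_n * J) :
    'Z_n * J :=
  (v.1 + j, v.2).

Definition vertex_shift (n : nat) (j k : 'Z_n) : 'Z_n := k + j.

(* Main.v *)
Require Import Defs.
From mathcomp Require Import all_boot all_order all_algebra.
From mathcomp Require Import finfield zify.
From mathcomp Require Import reals.

(* By equivariance [f (i, l) = i + c l] with [c l = f (0, l)].  By the
   Erdos-Ginzburg-Ziv theorem some [n] of the [2n - 1] values [c l] have sum [0],
   and then, by a theorem of M. Hall, rows [r l] can be chosen for these [n]
   columns such that both [l |-> r l] and [l |-> r l + c l] are bijective.  The
   squares [(r l, l)] form a face which [f] maps bijectively onto the vertices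
   of the simplex. *)

Set Implicit Arguments.
Unset Strict Implicit.
Unset Printing Implicit Defensive.

Import GRing.Theory.

(** * The Erdos-Ginzburg-Ziv theorem *)

Lemma card_supersets (T : finType) (A D : {set T}) (k : nat) :
  D \subset A -> (#|D| <= k)%N ->
  #|[set B : {set T} | [&& D \subset B, B \subset A & #|B| == k]]|
    = 'C(#|A| - #|D|, k - #|D|).
Proof.
move=> DA leDk.
rewrite -cardsDS // -cards_draws.
rewrite -[RHS](card_in_imset (f := fun C : {set T} => C :|: D)); last first.
  move=> C1 C2; rewrite !inE !subsetD => /andP[/andP[_ d1] _] /andP[/andP[_ d2] _] e.
  have := congr1 (fun E => E :\: D) e; rewrite !setDUl setDv !setU0.
  by rewrite !(setDidPl _).
apply: eq_card => B; rewrite inE; apply/and3P/imsetP => [[DB BA /eqP cB]|[C]].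
  exists (B :\: D); last by rewrite -[LHS](setID B D) (setIidPr DB) setUC.
  by rewrite inE setSD // cardsDS // cB /=.
rewrite inE subsetD => /andP[/andP[CA dCD] /eqP cC] ->.
split; first exact: subsetUr.
  by rewrite subUset CA.
by rewrite cardsU disjoint_setI0 // cards0 subn0 cC subnK.
Qed.

(** Since [k < p], the factor [p] occurs in the numerator [((2 * p - 1) - k)!]; since [0 < k], it
    divides neither factorial [(p - k)!] nor [(p - 1)!] of the denominator. *)
Lemma prime_dvd_bin (p k : nat) : prime p -> (0 < k < p)%N ->
  p %| 'C((2 * p - 1) - k, p - k).
Proof.
move=> p_pr /andP[k0 kp].
have ndvd m : (m < p)%N -> ~~ (p %| m`!).
  by move=> mp; rewrite fact_prod (Euclid_dvd_prod _ _ _ p_pr) big_has_cond;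
    apply/hasPn => i /=;
    rewrite mem_index_iota => /andP[i0 im]; rewrite gtnNdvd //; lia.
have le : (p - k <= (2 * p - 1) - k)%N by lia.
have := bin_fact le; have -> : ((2 * p - 1) - k - (p - k) = p.-1)%N by lia.
move=> e; have : p %| ((2 * p - 1) - k)`! by apply: dvdn_fact; lia.
rewrite -e !Euclid_dvdM // (negPf (ndvd (p - k)%N _)) ?(negPf (ndvd p.-1 _)) ?orbF //; lia.
Qed.

(** Up to symmetry, the numerator is the product of [p + 1, ..., 2 * p - 1], all strictly between
    [p] and [2 * p]. *)
Lemma prime_ndvd_bin (p : nat) : prime p -> ~~ (p %| 'C(2 * p - 1, p)).
Proof.
move=> p_pr; have p0 := prime_gt0 p_pr.
have -> : 'C(2 * p - 1, p) = 'C(2 * p - 1, p.-1).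
  by rewrite -bin_sub; [congr ('C(_, _)); lia | lia].
apply/negP => dv; have : p %| (2 * p - 1) ^_ p.-1.
  by rewrite -bin_ffact dvdn_mulr.
rewrite ffact_prod (Euclid_dvd_prod _ _ _ p_pr) big_has_cond.
case/hasP => i _ /= /dvdnP[q]; have := ltn_ord i.
case: q => [|[|q]]; [lia | lia | nia].
Qed.

(* Summing [(\sum_(j in B) c j) ^+ p.-1] over the [p]-subsets [B] of a set of
   size [2p-1]: each monomial occurs a multiple of [p] times, whereas without a
   zero sum every term would be [1] by Fermat. *)
Lemma egz_prime (J : finType) (p : nat) (c : J -> nat) (A : {set J}) :
  prime p -> #|A| = (2 * p - 1)%N ->
  exists2 B : {set J}, B \subset A & #|B| = p /\ p %| \sum_(j in B) c j.
Proof.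
move=> p_pr cA; have p1 := prime_gt1 p_pr.
pose good (B : {set J}) := (B \subset A) && (#|B| == p).
have [/existsP[B /andP[/andP[BA /eqP cB] dB]]|nex] :=
  boolP [exists B : {set J}, good B && (p %| \sum_(j in B) c j)%N].
  by exists B.
exfalso.
have natF (m : nat) : (m%:R == 0 :> 'F_p)%R = (p %| m).
  by rewrite -(dvdn_pcharf (pchar_Fp p_pr)).
have : (\sum_(B | good B) (\sum_(j in B) (c j)%:R) ^+ p.-1 = 0 :> 'F_p)%R.
  transitivity (\sum_(B | good B) \sum_(f : {ffun 'I_p.-1 -> J} | [forall i, f i \in B])
      \prod_i (c (f i))%:R : 'F_p)%R.
    apply: eq_bigr => B _.
    rewrite -[in LHS](card_ord p.-1) -prodr_const.
    rewrite (bigA_distr_big_dep) /=.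
    by apply: eq_bigl => f; apply/familyP/forallP.
  (* The monomial of [f] is now counted once for each [p]-subset of [A] that contains the image [D]
     of [f]. *)
  rewrite (exchange_big_dep xpredT) //=; apply: big1 => f _.
  rewrite sumr_const.
  set D := f @: setT.
  have eqS : [pred B | good B & [forall i, f i \in B]] =i
     [set B : {set J} | [&& D \subset B, B \subset A & #|B| == p]].
    move=> B; rewrite !inE /good andbC; congr (_ && _).
    apply/forallP/subsetP => [h _ /imsetP[i _ ->] //|h i].
    by apply: h; apply: imset_f.
  rewrite (eq_card eqS).
  have cD : (0 < #|D| < p)%N.
    apply/andP; split.
      by apply/card_gt0P; exists (f (Ordinal (ltac:(lia) : (0 < p.-1)%N))); apply: imset_f.
    by have := leq_imset_card f setT; rewrite cardsT card_ord -/D; lia.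
  have [DA|nDA] := boolP (D \subset A); last first.
    rewrite eq_card0 ?mulr0n // => B; rewrite !inE; apply/and3P => -[DB BA _].
    by rewrite (subset_trans DB BA) in nDA.
  rewrite card_supersets //; last by case/andP: cD => _ /ltnW.
  rewrite -mulr_natr cA; apply/eqP; rewrite mulf_eq0 natF prime_dvd_bin ?orbT //.
have -> : (\sum_(B | good B) (\sum_(j in B) (c j)%:R) ^+ p.-1
   = \sum_(B | good B) 1 :> 'F_p)%R.
  apply: eq_bigr => B gB.
  have nz : (\sum_(j in B) (c j)%:R != 0 :> 'F_p)%R.
    by rewrite -natr_sum natF; apply: contra nex => d; apply/existsP; exists B; rewrite gB.
  apply: (mulfI nz); rewrite mulr1 -exprS prednK; last lia.
  by have := expf_card (\sum_(j in B) (c j)%:R : 'F_p)%R; rewrite card_Fp.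
rewrite sumr_const => /eqP; rewrite natF; apply/negP.
suff -> : #|[pred B | good B]| = 'C(2 * p - 1, p) by exact: prime_ndvd_bin.
by rewrite -cA -cards_draws; apply: eq_card => B; rewrite !inE.
Qed.

Lemma exists_subset_card (T : finType) (A : {set T}) (k : nat) :
  (k <= #|A|)%N -> exists2 B : {set T}, B \subset A & #|B| = k.
Proof.
move=> kA; have : (0 < #|[set B : {set T} | B \subset A & #|B| == k]|)%N.
  by rewrite cards_draws bin_gt0.
by case/card_gt0P => B; rewrite inE => /andP[BA /eqP cB]; exists B.
Qed.

(** Strong induction with [n = m * p], [p] prime: the prime case extracts [2 * m - 1] disjoint
    blocks of size [p] with sums divisible by [p], and the case [m] is applied to the blocks
    themselves, weighted by their sums divided by [p]. *)
Theorem erdos_ginzburg_ziv (n : nat) (J : finType) (c : J -> nat) (A : {set J}) :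
  (0 < n)%N -> (2 * n - 1 <= #|A|)%N ->
  exists2 B : {set J}, B \subset A & #|B| = n /\ n %| \sum_(j in B) c j.
Proof.
elim/ltn_ind: n J c A => n IH J c A n0 cA.
have [n1|n1] := leqP n 1.
  have [B BA cB] := @exists_subset_card _ A n ltac:(lia).
  by exists B => //; split=> //; have -> : n = 1%N by lia.
set p := pdiv n; have p_pr : prime p by exact: pdiv_prime.
have p1 := prime_gt1 p_pr.
have /dvdnP[m def_n] : p %| n := pdiv_dvd n.
have m0 : (0 < m)%N by case: m def_n => [|//]; lia.
have mn : (m < n)%N by nia.
have blocks k : (k <= 2 * m - 1)%N -> exists P : {set {set J}},
  [/\ trivIset P, #|P| = k & forall B, B \in P ->
      [/\ B \subset A, #|B| = p & p %| \sum_(j in B) c j]].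
  elim: k => [_|k IHk km].
    exists set0; split; [|exact: cards0|by move=> B; rewrite inE].
    by apply/trivIsetP => ?; rewrite inE.
  have [P [tP cP hP]] := IHk (ltnW km).
  have cov : #|cover P| = (k * p)%N.
    rewrite -(eqP tP) (eq_bigr (fun=> p)); last by move=> B /hP[].
    by rewrite sum_nat_const cP.
  (* At most [2 * m - 2] blocks are in use, so at least [2 * m * p - 1 - (2 * m - 2) * p] elements
     remain. *)
  have cAP : (2 * p - 1 <= #|A :\: cover P|)%N.
    have := cardsID (cover P) A; have := subset_leq_card (subsetIr A (cover P)).
    rewrite cov; nia.
  have [A' sA' cA'] := exists_subset_card cAP.
  have [B BA' [cB dB]] := egz_prime c p_pr cA'.
  have /andP[BA dBP] : (B \subset A) && [disjoint B & cover P].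
    by rewrite -subsetD (subset_trans BA').
  have disj B' : B' \in P -> [disjoint B & B'].
    by move=> B'P; apply: disjointWr dBP; apply: bigcup_sup.
  have B0 : B != set0 by rewrite -card_gt0 cB; lia.
  have BnP : B \notin P.
    by apply: contra B0 => /disj; rewrite -setI_eq0 setIid.
  exists (B |: P); split; last 1 first.
  - by move=> C /setU1P[->|/hP].
  - apply/trivIsetP => C D /setU1P[->|CP] /setU1P[->|DP]; rewrite ?eqxx // => CD.
    + exact: disj.
    + by rewrite disjoint_sym disj.
    + exact: (trivIsetP tP).
  - by rewrite cardsU1 BnP cP.
have [P [tP cP hP]] := blocks _ (leqnn _).
have [Q QP [cQ dQ]] := IH m mn _ (fun B : {set J} => (\sum_(j in B) c j) %/ p)%N P m0
   ltac:(by rewrite cP).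
have tQ := trivIsetS QP tP.
exists (cover Q).
  by apply/bigcupsP => B /(subsetP QP)/hP[].
split.
  rewrite -(eqP tQ) (eq_bigr (fun=> p)); last by move=> B /(subsetP QP)/hP[].
  by rewrite sum_nat_const cQ.
rewrite (big_trivIset _ tQ) /= def_n.
rewrite (eq_bigr (fun B : {set J} => (\sum_(j in B) c j) %/ p * p)%N); last first.
  by move=> B /(subsetP QP)/hP[_ _ dB]; rewrite divnK.
by rewrite -big_distrl /= dvdn_mul.
Qed.

(** * Hall's theorem on differences of bijections *)

Lemma first_return (T : finType) (s : T -> T) (U : {set T}) (v : T) :
  injective s -> v \in U ->
  exists a (P : {set T}),
    [/\ a \in U, [disjoint P & U] & s @: (v |: P) = a |: P].
Proof.
move=> s_inj vU.
have ex : exists m, (0 < m) && (iter m s v \in U).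
  by exists (order s v); rewrite order_gt0 iter_order.
case: (ex_minnP ex) => m /andP[m0 mU] min_m.
(* [P] consists of the iterates strictly between [v] and its first return [a] to [U]; applying [s]
   shifts this chain by one, dropping [v] and adding [a]. *)
pose P := [set i | [exists k : 'I_m, (0 < k) && (i == iter k s v)]].
have PP i : i \in P -> exists2 k, 0 < k < m & i = iter k s v.
  by rewrite inE => /existsP[k /andP[k0 /eqP ->]]; exists k; rewrite ?k0 ?ltn_ord.
have vP k : k < m -> iter k s v \in v |: P.
  case: k => [|k] km; first exact: setU11.
  by apply/setU1r; rewrite inE; apply/existsP; exists (Ordinal km) => /=.
have PvP i : i \in v |: P -> exists2 k, k < m & i = iter k s v.
  by case/setU1P => [->|/PP[k /andP[_ km] ->]]; [exists 0 | exists k].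
exists (iter m s v), P; split=> //.
  apply/pred0P => i; apply/andP => -[/PP[k /andP[k0 km] ->] kU].
  by have := min_m k; rewrite k0 [_ \in U]kU => /(_ isT); rewrite leqNgt km.
apply/setP => i; apply/imsetP/setU1P => [[j /PvP[k km ->] ->]|[->|/PP[k /andP[k0 km] ->]]].
- have [->|km1] := eqVneq m k.+1; [by left | right].
  rewrite inE; apply/existsP.
  by exists (Ordinal (ltac:(lia) : k.+1 < m)) => /=; rewrite eqxx.
- by exists (iter m.-1 s v); [apply: vP; lia | rewrite -iterS prednK].
- by exists (iter k.-1 s v); [apply: vP; lia | rewrite -iterS prednK].
Qed.

Local Open Scope ring_scope.

Definition difference_of_injections (I : Type) (G : zmodType) (c : I -> G) :=
  exists2 y : I -> G, injective y & injective (fun i => y i + c i).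

Lemma injective_if (I : finType) (T : Type) (Q : {set I}) (F H : I -> T) :
  {in Q &, injective F} -> {in ~: Q &, injective H} ->
  (forall i j, i \in Q -> j \notin Q -> F i <> H j) ->
  injective (fun i => if i \in Q then F i else H i).
Proof.
move=> F_inj H_inj FH i j; case: ifPn => iQ; case: ifPn => jQ.
- exact: F_inj.
- by move/FH => /(_ iQ jQ).
- by move/esym/FH => /(_ jQ iQ).
- by apply: H_inj; rewrite inE.
Qed.

(* With [x i = y i + c i] and [S = y u + y v + c' u], the reflection
   [(y i, x i) |-> (S - x i, S - y i)] preserves differences.  It is applied on
   a set [P] avoiding [u] and [v] and chosen such that the reflected values fit
   together with the two new pairs at [u] and [v]. *)
Lemma difference_exchange (I : finType) (G : finZmodType) (c c' : I -> G) (u v : I) :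
  #|I| = #|G| -> u != v -> (forall i, i != u -> i != v -> c i = c' i) ->
  c u + c v = c' u + c' v ->
  difference_of_injections c -> difference_of_injections c'.
Proof.
move=> cIG uv cc' cuv [y y_inj x_inj].
set x := fun i => y i + c i in x_inj.
have [x1 xK x1K] : bijective x by apply: inj_card_bij; rewrite ?cIG.
pose S := y u + y v + c' u.
pose s i := x1 (S - y i).
have xs i : x (s i) = S - y i by rewrite /s x1K.
have s_inj : injective s.
  by move=> i j /(congr1 x); rewrite !xs => /addrI /oppr_inj /y_inj.
(* As [S - x (s k) = y k], the values [S - x j] for [j] in [a |: P] are exactly the old values [y k]
   for [k] in [v |: P]. So reflection only permutes values of [y], and likewise it exchanges no
   value of [x] outside those on [a |: P]. *)
have [a [P [aU dPU sP]]] := first_return s_inj (set22 u v).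
have /andP[uP vP] : (u \notin P) && (v \notin P).
  by rewrite !(disjointFl dPU) // ?set21 ?set22.
have aP : a \notin P by rewrite (disjointFl dPU).
(* [b] is the other element of the pair: [x a] is used up by the reflection, and [x b] remains
   available for the index [v]. *)
pose b := if a == u then v else u.
have bU : b \in [set u; v] by rewrite /b; case: ifP; rewrite ?set21 ?set22.
have bP : b \notin P by rewrite (disjointFl dPU).
have ab : a != b by rewrite /b; case: ifPn => [/eqP ->|].
have xab : x a + x b = x u + x v.
  rewrite /b; case: ifPn => [/eqP -> //|au].
  by move: aU; rewrite !inE (negPf au) => /eqP ->; rewrite addrC.
(* The new pairs are [(y u, S - y v)] at [u] and [(S - x a, x b)] at [v]; [S] is chosen so that the
   first has difference [c' u]. *)
pose y' i := if i \in v |: P then S - x (if i == v then a else i) else y i.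
pose x' i := if i \in u |: P then S - y (if i == u then v else i)
             else x (if i == v then b else i).
exists y'.
  apply: injective_if => [i j|i j _ _ /y_inj //|i j].
    rewrite !inE => iP jP /addrI /oppr_inj /x_inj.
    case: eqVneq iP => [-> _|_ /= iP]; case: eqVneq jP => [-> _|_ /= jP] // e.
      by rewrite -e (negPf aP) in jP.
    by rewrite e (negPf aP) in iP.
  move=> iP jP e; case/negP: jP.
  have : (if i == v then a else i) \in s @: (v |: P).
    by rewrite sP; move: iP; rewrite !inE; case: eqVneq; rewrite ?eqxx //= => _ ->; rewrite orbT.
  case/imsetP => k kP ek; move: e; rewrite ek xs subKr => /y_inj <- //.
have x'E i : y' i + c' i = x' i.
  rewrite /y' /x' !inE.
  have [->|iu] := eqVneq i u; first by rewrite (negPf uv) (negPf uP) /= /S [y u + y v + _]addrAC addrK.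
  have [->|iv] := eqVneq i v.
    (* At [v] the claim amounts to [x u + x v = S + c' v], which is the hypothesis [cuv] on sums. *)
    rewrite (negPf vP) /=; apply: (addrI (x a)).
    by rewrite xab addrA [x a + _]addrC subrK /S /x addrACA cuv addrA.
  by rewrite /x cc' //=; case: ifP => _; rewrite ?opprD ?addrA ?subrK.
apply: (eq_inj _ (fun i => esym (x'E i))).
apply: injective_if => [i j|i j|i j].
- rewrite !inE => iP jP /addrI /oppr_inj /y_inj.
  case: eqVneq iP => [-> _|_ /= iP]; case: eqVneq jP => [-> _|_ /= jP] // e.
    by rewrite -e (negPf vP) in jP.
  by rewrite e (negPf vP) in iP.
- rewrite !inE !negb_or => /andP[iu _] /andP[ju _] /x_inj.
  have bE k : k != u -> k != v -> b != k.
    by move=> ku kv; apply: contraTneq bU => ->; rewrite !inE negb_or ku.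
  case: (eqVneq i v) => [->|iv]; case: (eqVneq j v) => [->|jv] // e.
    by case/eqP: (bE j ju jv).
  by case/eqP: (bE i iu iv).
move=> iP; rewrite !inE negb_or => /andP[ju jP].
rewrite -xs => /x_inj e.
have : s (if i == u then v else i) \in a |: P.
  rewrite -sP; apply: imset_f; move: iP; rewrite !inE.
  by case: eqVneq; rewrite ?eqxx //= => _ ->; rewrite orbT.
rewrite e; case: eqVneq => [_|jv]; rewrite !inE.
  by rewrite eq_sym (negPf ab) (negPf bP).
rewrite (negPf jP) orbF => /eqP ja; move: aU; rewrite -ja !inE.
by rewrite (negPf ju) (negPf jv).
Qed.

(** Induction on the size of the support of [c]. For [c = 0] any enumeration of [G] serves.
    Otherwise the zero sum forces two nonzero values; moving [c u] onto [v] removes [u] from the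
    support, and [difference_exchange] leads back to [c]. *)
Theorem hall_difference (I : finType) (G : finZmodType) (c : I -> G) :
  #|I| = #|G| -> \sum_i c i = 0 -> difference_of_injections c.
Proof.
move=> cIG; have [N] := ubnP #|[set i | c i != 0]|.
elim: N c => // N IH c; rewrite ltnS => cN c0.
have [c_eq0|[u]] := set_0Vmem [set i | c i != 0].
  have cE i : c i = 0.
    by have := in_set0 i; rewrite -c_eq0 inE => /negbFE/eqP.
  pose y i : G := enum_val (cast_ord cIG (enum_rank i)).
  have y_inj : injective y.
    by apply: inj_comp enum_val_inj (inj_comp (@cast_ord_inj _ _ _) enum_rank_inj).
  exists y => //; apply: eq_inj y_inj _ => i.
  by rewrite cE addr0.
rewrite inE => cu.
have [v /andP[vu cv]|nv] := pickP (fun v => (v != u) && (c v != 0)); last first.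
  move: c0; rewrite (bigD1 u) //= big1 ?addr0 => [/eqP|i iu]; first by rewrite (negPf cu).
  by apply/eqP; have := nv i; rewrite iu => /negbFE.
pose c1 i := if i == u then 0 else if i == v then c u + c v else c i.
apply: (@difference_exchange _ _ c1 c u v) => //.
- by rewrite eq_sym.
- by move=> i iu iv; rewrite /c1 (negPf iu) (negPf iv).
- by rewrite /c1 !eqxx (negPf vu) add0r.
apply: IH.
  apply: leq_trans cN; apply: proper_card; apply/properP; split.
    apply/subsetP => i; rewrite !inE /c1.
    by case: (eqVneq i u) => [->|_]; rewrite ?eqxx //; case: (eqVneq i v) => [->|].
  by exists u; rewrite !inE // /c1 !eqxx.
move: c0; rewrite (bigD1 u) // (bigD1 v) //= => c0.
rewrite (bigD1 u) // (bigD1 v) //= -[RHS]c0.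
have -> : c1 u = 0 by rewrite /c1 eqxx.
have -> : c1 v = c u + c v by rewrite /c1 (negPf vu) eqxx.
rewrite add0r addrA; congr (_ + _).
by apply: eq_bigr => i /andP[iu iv]; rewrite /c1 (negPf iu) (negPf iv).
Qed.

(** * A face mapped bijectively onto the vertices, and surjectivity *)

Lemma rainbow_face (n : nat) (c : 'I_(2 * n - 1) -> 'Z_n) : (1 < n)%N ->
  exists (k : nat) (l : 'I_k -> 'I_(2 * n - 1)) (r : 'I_k -> 'Z_n),
    [/\ injective l, injective r & bijective (fun i => r i + c (l i))].
Proof.
move=> n1; have cardZ : #|'Z_n| = n by rewrite card_ord Zp_cast.
have [B _ [cB dB]] : exists2 B : {set 'I_(2 * n - 1)},
    B \subset setT & #|B| = n /\ (n %| \sum_(j in B) c j)%N.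
  by apply: erdos_ginzburg_ziv; rewrite ?cardsT ?card_ord // ltnW.
pose l (i : 'I_#|B|) : 'I_(2 * n - 1) := enum_val i.
have [r r_inj x_inj] : difference_of_injections (fun i => c (l i)).
  apply: hall_difference; first by rewrite card_ord cB.
  rewrite -(big_enum_val (fun j => c j)).
  (* Divisibility by [n] of the sum of representatives becomes a zero sum in ['Z_n]. *)
  rewrite (eq_bigr (fun j => (c j : nat)%:R)); last by move=> j _; rewrite natr_Zp.
  rewrite -natr_sum; case/dvdnP: dB => q ->.
  by rewrite natrM pchar_Zp ?mulr0.
(* Taking [k] to be [#|B|] avoids a cast along [#|B| = n]. *)
exists #|B|, l, r; split=> //; first exact: enum_val_inj.
by apply: inj_card_bij; rewrite // cardZ card_ord cB.
Qed.

(** The preimage carries each coordinate [y w] on the one vertex of the face above [w] and vanishes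
    off the face, so every fibre sum has at most one nonzero term. *)
Lemma realization_map_onto_face (R : realFieldType) (V W K : finType)
    (X : simplicial_complex V) (Y : simplicial_complex W)
    (f : simplicial_map X Y) (v : K -> V) :
  [set v k | k : K] \in faces X -> bijective (f \o v) ->
  forall y : realization R Y, exists x : realization R X, realization_map f x = y.
Proof.
move=> vX [g fvK gK] y.
have /and3P[/forallP y_ge0 /eqP sum_y _] := coordsP y.
pose x := [ffun p => if p \in [set v k | k : K] then y (f p) else 0] : {ffun V -> R}.
have push_x : push_coords f x = y.
  apply/ffunP => w; rewrite ffunE (bigD1 (v (g w))) /=; last first.
    by apply/eqP; have /= := gK w.
  rewrite big1 ?addr0 => [|p /andP[/eqP fp pvw]].
    by rewrite ffunE imset_f //; have /= -> := gK w.
  rewrite ffunE; case: imsetP => // -[k _ pk]; case/eqP: pvw.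
  by rewrite -fp pk; have /= -> := fvK k.
have xP : in_realization X x.
  apply/and3P; split.
  - by apply/forallP => p; rewrite ffunE; case: ifP.
  - rewrite -sum_y -push_x (partition_big f xpredT) //=.
    by apply/eqP/eq_bigr => w _; rewrite [RHS]ffunE.
  - apply: face_sub vX _; apply/subsetP => p; rewrite inE ffunE.
    by case: ifP; rewrite ?eqxx.
by exists (RealizationPoint xP); apply: val_inj.
Qed.

Local Close Scope ring_scope.

Theorem theorem5p6 (R : realType) (n : nat) (hn : (2 <= n)%N)
    (f : simplicial_map (chessboard 'Z_n 'I_(2 * n - 1)) (simplex 'Z_n))
    (hf : equivariant (@row_shift n 'I_(2 * n - 1)) (@vertex_shift n) f) :
  forall y : realization R (simplex 'Z_n),
    exists x : realization R (chessboard 'Z_n 'I_(2 * n - 1)),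
      realization_map f x = y.
Proof.
have [k [l [r [l_inj r_inj x_bij]]]] := rainbow_face (fun j => f (0%R, j)) hn.
apply: (@realization_map_onto_face _ _ _ _ _ _ f (fun i : 'I_k => (r i, l i))).
  rewrite inE; apply/forall_inP => _ /imsetP[i _ ->].
  apply/forall_inP => _ /imsetP[j _ ->]; apply/implyP => ij.
  have {}ij : i != j by apply: contraNneq ij => ->.
  by rewrite /= (inj_eq r_inj) (inj_eq l_inj) ij.
apply: (eq_bij x_bij) => i /=.
(* The square [(r i, l i)] is the shift by [r i] of the row-zero square in its column. *)
have := hf (r i) (0%R, l i); rewrite /row_shift /vertex_shift /= GRing.add0r => ->.
exact: GRing.addrC.
Qed.
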